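(* Assume the loss $f(\cdot,z)$ is $\beta$-smooth for all $z\in\mathcal{Z}$. Consider full-batch GD with $T$ iterations and learning rates satisfying $\eta_t\le C/t\le 1/\beta$ for all $t\le T+1$. Let $\epsilon=\beta C<1$ and $\bar C(\epsilon,T)=\min\{\epsilon+1/2,\ \epsilon\log(eT)\}$. Then $$|\epsilon_{\mathrm{gen}}|\le\frac{4\sqrt2}{n}\sqrt{(\epsilon_{\mathrm{opt}}+\epsilon_{\mathbf{c}})\,\epsilon_{\mathrm{path}}}\,(eT)^{\epsilon}\,\bar C^{1/2}(\epsilon,T)+8\frac{\epsilon_{\mathrm{path}}}{n^2}(eT)^{2\epsilon}\bar C(\epsilon,T)\le\frac{4\sqrt3\,(eT)^{\epsilon}}{n}\sqrt{(\epsilon_{\mathrm{opt}}+\epsilon_{\mathbf{c}})\,\epsilon_{\mathrm{path}}}+12\frac{(eT)^{2\epsilon}}{n^2}\epsilon_{\mathrm{path}}.$$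
   Context: Let $\mathcal{D}$ be a distribution on $\mathcal{Z}$ and $z_1,\dots,z_n,z_i'$ i.i.d. from $\mathcal{D}$; $S=(z_1,\dots,z_n)$. The loss $f:\mathbb{R}^d\times\mathcal{Z}\to[0,\infty)$ is non-negative and $\beta$-smooth ($\|\nabla f(w,z)-\nabla f(u,z)\|_2\le\beta\|w-u\|_2$), possibly nonconvex. $R(w)=\mathbb{E}_{Z\sim\mathcal{D}}[f(w,Z)]$, $R_S(w)=\frac1n\sum_j f(w,z_j)$, $W^*_S$ a minimizer of $R_S$ (assumed to exist). Full-batch GD: from a fixed $W_1$, $W_{t+1}=W_t-\frac{\eta_t}{n}\sum_{j=1}^n\nabla f(W_t,z_j)$, $t=1,\dots,T$, output $A(S)=W_{T+1}$. Definitions: $\epsilon_{\mathrm{gen}}=\mathbb{E}[R(A(S))-R_S(A(S))]$; $\epsilon_{\mathrm{opt}}=\mathbb{E}[R_S(A(S))-R_S(W^*_S)]$; $\epsilon_{\mathbf{c}}=\mathbb{E}[R_S(W^*_S)]$; $\epsilon_{\mathrm{path}}=\sum_{t=1}^T\eta_t\mathbb{E}[\|\nabla f(W_t,z_i)\|_2^2]$ for a fixed index $i$. *)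

(* Defs.v *)
From HB Require Import structures.
From mathcomp Require Import all_boot all_order all_algebra.
From mathcomp Require Import all_classical all_reals all_analysis.
Unset Printing Implicit Defensive.
Import Order.TTheory GRing.Theory Num.Theory.
Import numFieldNormedType.Exports.
Local Open Scope classical_set_scope.
Local Open Scope ring_scope.

Section GDDefs.
Variables (R : realType) (d0 : measure_display) (Z : measurableType d0).
Variable (D : probability Z R).
Variable (d : nat).

(* Euclidean norm on R^d (the library's norm on 'rV is the sup norm). *)
Definition norm2 (v : 'rV[R]_d) : R := Num.sqrt (\sum_(j < d) v ord0 j ^+ 2).

Definition grad (g : 'rV[R]_d -> R) (w : 'rV[R]_d) : 'rV[R]_d :=
  \row_(j < d) ('D_(delta_mx ord0 j) g w).

(* Expectation over an i.i.d. sample S = (z_1,...,z_k) ~ D^k of a non-negative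
   (extended-real valued) quantity, as the iterated integral
   \int dD(z_1) ... \int dD(z_k) g(z_1,...,z_k). *)
Fixpoint sampleE (k : nat) : (k.-tuple Z -> \bar R) -> \bar R :=
  match k return (k.-tuple Z -> \bar R) -> \bar R with
  | 0 => fun g => g [tuple]
  | k'.+1 => fun g => (\int[D]_z sampleE k' (fun t : k'.-tuple Z => g [tuple of z :: t]))%E
  end.

Variable (f : 'rV[R]_d -> Z -> R).

Definition pop_risk (w : 'rV[R]_d) : \bar R := (\int[D]_z (f w z)%:E)%E.

Definition emp_risk (n : nat) (S : n.-tuple Z) (w : 'rV[R]_d) : R :=
  n%:R^-1 * \sum_(j < n) f w (tnth S j).

(* Full-batch GD: gd_iter W1 eta S k = W_{k+1}, i.e. W_1 = W1 and
   W_{t+1} = W_t - eta_t / n * sum_j grad f(W_t, z_j). *)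
Fixpoint gd_iter (n : nat) (W1 : 'rV[R]_d) (eta : nat -> R) (S : n.-tuple Z)
    (k : nat) : 'rV[R]_d :=
  match k with
  | 0 => W1
  | k'.+1 => let w := gd_iter n W1 eta S k' in
             w - (eta k'.+1 / n%:R) *: \sum_(j < n) grad (f ^~ (tnth S j)) w
  end.

(* W_t for t >= 1 *)
Definition gdW n W1 eta (S : n.-tuple Z) (t : nat) := gd_iter n W1 eta S t.-1.

Definition gd_out n W1 eta T (S : n.-tuple Z) := gd_iter n W1 eta S T.

Definition E_pop_out n W1 eta T : \bar R :=
  sampleE n (fun S : n.-tuple Z => pop_risk (gd_out n W1 eta T S)).
Definition E_emp_out n W1 eta T : \bar R :=
  sampleE n (fun S : n.-tuple Z => (emp_risk n S (gd_out n W1 eta T S))%:E).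
Definition E_emp_star n (Wstar : n.-tuple Z -> 'rV[R]_d) : \bar R :=
  sampleE n (fun S : n.-tuple Z => (emp_risk n S (Wstar S))%:E).
Definition E_gradsq n W1 eta (i : 'I_n) (t : nat) : \bar R :=
  sampleE n (fun S : n.-tuple Z =>
    ((norm2 (grad (f ^~ (tnth S i)) (gdW n W1 eta S t))) ^+ 2)%:E).

Definition eps_gen n W1 eta T : R :=
  fine (E_pop_out n W1 eta T) - fine (E_emp_out n W1 eta T).
Definition eps_opt n W1 eta T Wstar : R :=
  fine (E_emp_out n W1 eta T) - fine (E_emp_star n Wstar).
Definition eps_c n Wstar : R := fine (E_emp_star n Wstar).
Definition eps_path (n : nat) W1 eta T (i : 'I_n) : R :=
  \sum_(1 <= t < T.+1) eta t * fine (E_gradsq n W1 eta i t).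

End GDDefs.

Definition Cbar (R : realType) (eps : R) (T : nat) : R :=
  Num.min (eps + 2^-1) (eps * ln (expR 1 * T%:R)).

Arguments norm2 {R d}.
Arguments grad {R d}.
Arguments sampleE {R d0 Z}.
Arguments pop_risk {R d0 Z} D {d}.
Arguments emp_risk {R d0 Z d}.
Arguments gd_iter {R d0 Z d}.
Arguments gdW {R d0 Z d}.
Arguments gd_out {R d0 Z d}.
Arguments E_pop_out {R d0 Z} D {d}.
Arguments E_emp_out {R d0 Z} D {d}.
Arguments E_emp_star {R d0 Z} D {d}.
Arguments E_gradsq {R d0 Z} D {d}.
Arguments eps_gen {R d0 Z} D {d}.
Arguments eps_opt {R d0 Z} D {d}.
Arguments eps_c {R d0 Z} D {d}.
Arguments eps_path {R d0 Z} D {d}.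
Arguments Cbar {R}.

(* Main.v *)
Require Import Defs.
From HB Require Import structures.
From mathcomp Require Import all_boot all_order all_algebra.
From mathcomp Require Import all_classical all_reals all_analysis.
From mathcomp Require Import measurable_realfun ring lra.
Import Order.TTheory GRing.Theory Num.Theory.
Import numFieldNormedType.Exports.
Local Open Scope classical_set_scope.
Local Open Scope ring_scope.

(* Let W_t be the iterates on a sample containing z at the index i, and W'_t
   those on the sample where z is replaced by an independent copy z'.  By
   exchangeability eps_gen = E[f(W_{T+1}, z') - f(W'_{T+1}, z')] and
   E[f(W'_{T+1}, z')] = E[R_S(A(S))] = eps_opt + eps_c =: a.  Smoothness and
   nonnegativity give |grad f|^2 <= 2 beta f, so for every l > 0, with
   x = |W_{T+1} - W'_{T+1}|, the loss difference is at most
   l f(W'_{T+1}, z') + (1 + 1/l) beta x^2 / 2.  One step of gradient descent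
   expands distances by at most 1 + beta eta_t, up to an error
   (eta_t / n)(|grad f(W_t, z)| + |grad f(W'_t, z')|); unrolling this and using
   (1 + eps/t)(t-1)^eps <= t^eps and Cauchy-Schwarz yields
   E[beta x^2] <= (4 / n^2) T^(2 eps) Cbar eps_path.  Optimizing over l replaces
   the Cauchy-Schwarz inequality for expectations, so that only integrals of
   nonnegative functions occur and no integrability has to be checked. *)

(** * Elementary inequalities *)

(** The form [s ^+ 2 * c - 2 * s * t * b + t ^+ 2 * a] is a sum of squares. At [(s, t) = (a, b)] it
    equals [a * (c * a - b ^+ 2)], which settles the case [a > 0]. *)
Lemma cauchy_schwarz_sum (R : realFieldType) (I : Type) (r : seq I)
  (P : pred I) (F G : I -> R) :
  (\sum_(i <- r | P i) F i * G i) ^+ 2 <=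
  (\sum_(i <- r | P i) F i ^+ 2) * (\sum_(i <- r | P i) G i ^+ 2).
Proof.
set a := \sum_(i <- r | P i) G i ^+ 2; set b := \sum_(i <- r | P i) F i * G i.
set c := \sum_(i <- r | P i) F i ^+ 2.
have quad s t : 0 <= s ^+ 2 * c - 2 * s * t * b + t ^+ 2 * a.
  have -> : s ^+ 2 * c - 2 * s * t * b + t ^+ 2 * a =
            \sum_(i <- r | P i) (s * F i - t * G i) ^+ 2.
    rewrite /a /b /c !mulr_sumr -sumrB -big_split /=.
    by apply: eq_bigr => i _; ring.
  by apply: sumr_ge0 => i _; exact: sqr_ge0.
have a0 : 0 <= a by apply: sumr_ge0 => i _; exact: sqr_ge0.
have c0 : 0 <= c by apply: sumr_ge0 => i _; exact: sqr_ge0.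
have [a1|a1] := eqVneq a 0.
  (* With [a = 0] the form takes the value [- (c + 2) * b ^+ 2] here, which forces [b = 0]. *)
  have := quad b (c + 1); rewrite a1 => q.
  have h : 0 <= b ^+ 2 by exact: sqr_ge0.
  by rewrite mulr0; nra.
have {}a0 : 0 < a by rewrite lt_def a1.
have := quad a b; have -> : a ^+ 2 * c - 2 * a * b * b + b ^+ 2 * a =
  a * (c * a - b ^+ 2) by ring.
by rewrite pmulr_rge0// subr_ge0.
Qed.

Section Norm2.
Context {R : realType} {d : nat}.
Implicit Types u v : 'rV[R]_d.

Definition dotr u v : R := \sum_(j < d) u ord0 j * v ord0 j.

Lemma norm2_ge0 u : 0 <= norm2 u.
Proof. exact: sqrtr_ge0. Qed.

Lemma sqr_norm2 u : norm2 u ^+ 2 = \sum_(j < d) u ord0 j ^+ 2.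
Proof. by rewrite sqr_sqrtr//; apply: sumr_ge0 => j _; exact: sqr_ge0. Qed.

Lemma dotr_le u v : dotr u v <= norm2 u * norm2 v.
Proof.
apply: le_trans (ler_norm _) _.
rewrite -ler_sqr ?nnegrE ?normr_ge0 ?mulr_ge0 ?norm2_ge0//.
rewrite exprMn !sqr_norm2 real_normK ?num_real//; exact: cauchy_schwarz_sum.
Qed.

Lemma norm2D u v : norm2 (u + v) <= norm2 u + norm2 v.
Proof.
rewrite -ler_sqr ?nnegrE ?addr_ge0 ?norm2_ge0//.
rewrite sqrrD !sqr_norm2.
have -> : \sum_(j < d) (u + v) ord0 j ^+ 2 =
  \sum_(j < d) u ord0 j ^+ 2 + 2 * dotr u v + \sum_(j < d) v ord0 j ^+ 2.
  rewrite mulr_sumr -!big_split /=; apply: eq_bigr => j _; rewrite mxE; ring.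
by rewrite -mulr_natl; have := dotr_le u v; lra.
Qed.

Lemma norm2Z a u : norm2 (a *: u) = `|a| * norm2 u.
Proof.
rewrite /norm2 -sqrtr_sqr -sqrtrM ?sqr_ge0// mulr_sumr; congr Num.sqrt.
by apply: eq_bigr => j _; rewrite mxE exprMn.
Qed.

Lemma norm2N u : norm2 (- u) = norm2 u.
Proof. by rewrite -scaleN1r norm2Z normrN1 mul1r. Qed.

Lemma norm2_0 : norm2 (0 : 'rV[R]_d) = 0.
Proof. by rewrite -(scale0r 0) norm2Z normr0 mul0r. Qed.

Lemma norm2_sum (I : Type) (r : seq I) (F : I -> 'rV[R]_d) :
  norm2 (\sum_(i <- r) F i) <= \sum_(i <- r) norm2 (F i).
Proof.
elim/big_ind2: _ => [|x1 x2 y1 y2 h1 h2|//]; first by rewrite norm2_0.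
exact: le_trans (norm2D _ _) (lerD h1 h2).
Qed.

End Norm2.

Section RealInequalities.
Context {R : realType}.

(** This is [ln (1 + x) <= x] at [x = - 1 / (k + 1)], where [1 + x = k / (k + 1)]. *)
Lemma inv_succ_le_ln (k : nat) :
  (0 < k)%N -> k.+1%:R^-1 <= ln k.+1%:R - ln k%:R :> R.
Proof.
move=> k0; have kR : 0 < k%:R :> R by rewrite ltr0n.
have e : k%:R / k.+1%:R = 1 - k.+1%:R^-1 :> R.
  by rewrite -natr1; field; rewrite natr1 pnatr_eq0.
have k1 : 0 < k%:R / k.+1%:R :> R by rewrite divr_gt0.
have h : -1 < - k.+1%:R^-1 :> R by move: k1; rewrite e; set w := _^-1; lra.
have := le_ln1Dx h; rewrite -e ln_div ?posrE ?ltr0n//.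
by set w := _^-1; lra.
Qed.

(** From [1 + x <= expR x] and the previous lemma. It lets a power of the step count absorb the
    expansion factor of a descent step. *)
Lemma powR_succ_ge (a : R) (k : nat) : 0 <= a -> (0 < k)%N ->
  (1 + a / k.+1%:R) * k%:R `^ a <= k.+1%:R `^ a.
Proof.
move=> a0 k0; rewrite /powR !gt_eqF ?ltr0n//.
have -> : a * ln k.+1%:R = a * (ln k.+1%:R - ln k%:R) + a * ln k%:R :> R by ring.
rewrite expRD ler_pM2r ?expR_gt0//.
apply: le_trans (expR_ge1Dx _) _; rewrite ler_expR ler_wpM2l//.
exact: inv_succ_le_ln.
Qed.

(** Telescoping of [inv_succ_le_ln]; since [ln (e k) = 1 + ln k], the extra 1 pays for the first
    term. *)
Lemma harmonic_le_ln (k : nat) : (0 < k)%N ->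
  \sum_(1 <= t < k.+1) t%:R^-1 <= ln (expR 1 * k%:R) :> R.
Proof.
elim: k => // -[_ _|k IH _]; first by rewrite big_nat1 mulr1 expRK invr1.
rewrite big_nat_recr//=; have := IH isT; have := @inv_succ_le_ln k.+1 isT.
rewrite !lnM ?posrE ?expR_gt0 ?ltr0n// expRK.
by set w := _^-1; set u := ln _; set v := ln _; lra.
Qed.

(* The negative correction on the right makes the induction telescope. *)
Lemma sum_powR_le (e : R) (k : nat) : 0 < e -> (0 < k)%N ->
  \sum_(1 <= t < k.+1) e / t%:R * t%:R `^ (- (2 * e)) <=
  e + 2^-1 - 2^-1 * k%:R `^ (- (2 * e)).
Proof.
move=> e0; elim: k => // -[_ _|k IH _].
  by rewrite big_nat1 powR1 mulr1 divr1; lra.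
rewrite big_nat_recr//=; have := IH isT.
have := @powR_succ_ge (2 * e) k.+1; rewrite !powRN.
have a0 : 0 < k.+1%:R `^ (2 * e) by rewrite powR_gt0.
have b0 : 0 < k.+2%:R `^ (2 * e) by rewrite powR_gt0.
move: a0 b0; set a := _ `^ _; set b := _ `^ _ => a0 b0 /(_ _ isT) h.
have {}h : (1 + 2 * e / k.+2%:R) * a <= b by apply: h; lra.
(* With exponent [2 * e], the new term is at most half of [a^-1 - b^-1], exactly the change of the
   correction. *)
have : (1 + 2 * e / k.+2%:R) / b <= a^-1 by rewrite ler_pdivrMr// ler_pdivlMl// mulrC.
by rewrite -mulrA; set w := e / _; lra.
Qed.

(** One branch of the minimum is the telescoped bound; the other bounds each power by 1 and keeps
    the harmonic sum. *)
Lemma sum_powR_le_Cbar (e : R) (T : nat) : 0 < e -> (0 < T)%N ->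
  \sum_(1 <= t < T.+1) e / t%:R * t%:R `^ (- (2 * e)) <= Cbar e T.
Proof.
move=> e0 T0; rewrite /Cbar le_min; apply/andP; split.
  apply: le_trans (sum_powR_le _ _ e0 T0) _.
  by rewrite gerBl mulr_ge0 ?powR_ge0 ?invr_ge0.
apply: (@le_trans _ _ (e * \sum_(1 <= t < T.+1) t%:R^-1)); last first.
  by rewrite ler_wpM2l ?harmonic_le_ln ?ltW.
rewrite mulr_sumr !big_nat; apply: ler_sum => t /andP[t0 _].
apply: ler_piMr; first by rewrite mulr_ge0 ?invr_ge0 ?ler0n// ltW.
rewrite powRN invf_le1 ?powR_gt0 ?ltr0n//.
rewrite -[leLHS](powRr0 t%:R); apply: ler_powR; first by rewrite ler1n.
by rewrite mulr_ge0// ltW.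
Qed.

(** The minimizer is [l = sqrt (b / a)]. If [a] or [b] vanishes, the infimum 0 is only approached,
    hence the arguments with an arbitrary [e > 0]. *)
Lemma young_optimize (x a b : R) : 0 <= a -> 0 <= b ->
  (forall l, 0 < l -> x <= l * a + b / l) -> x <= 2 * Num.sqrt (a * b).
Proof.
move=> a0 b0 h; rewrite sqrtrM//.
have [a1|a1] := eqVneq a 0.
  rewrite a1 sqrtr0 mul0r mulr0; apply/ler_addgt0Pr => e e0; rewrite add0r.
  (* This choice makes [b / l] at most [e]; the [+ 1] keeps [l] positive when [b = 0]. *)
  have := h ((b + 1) / e); rewrite a1 mulr0 add0r => /(_ _)/le_trans; apply.
    by rewrite divr_gt0//; lra.
  by rewrite invf_div mulrA ler_pdivrMr; nra.
have [b1|b1] := eqVneq b 0.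
  rewrite b1 sqrtr0 !mulr0; apply/ler_addgt0Pr => e e0; rewrite add0r.
  have := h (e / (a + 1)); rewrite b1 mul0r addr0 => /(_ _)/le_trans; apply.
    by rewrite divr_gt0//; lra.
  by rewrite mulrAC ler_pdivrMr; nra.
have sa : 0 < Num.sqrt a by rewrite sqrtr_gt0 lt_def a1.
have sb : 0 < Num.sqrt b by rewrite sqrtr_gt0 lt_def b1.
apply: le_trans (h (Num.sqrt b / Num.sqrt a) _) _; first exact: divr_gt0.
have ea := sqr_sqrtr a0; have eb := sqr_sqrtr b0.
move: sa sb ea eb; set s := Num.sqrt a; set t := Num.sqrt b => s0 t0 <- <-.
by rewrite le_eqVlt; apply/orP; left; apply/eqP; field; rewrite !gt_eqF.
Qed.

End RealInequalities.

(** * Smooth nonnegative functions *)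

Section Smooth.
Context {R : realType} {d : nat}.
Variables (g : 'rV[R]_d -> R) (beta : R).
Hypothesis beta0 : 0 < beta.
Hypothesis dg : forall w, differentiable g w.
Hypothesis smooth_g :
  forall w u, norm2 (grad g w - grad g u) <= beta * norm2 (w - u).
Implicit Types u v w : 'rV[R]_d.

Lemma dotrBl u v w : dotr (u - v) w = dotr u w - dotr v w.
Proof. by rewrite -sumrB; apply: eq_bigr => j _; rewrite !mxE mulrBl. Qed.

Lemma dotrr u : dotr u u = norm2 u ^+ 2.
Proof. by rewrite sqr_norm2; apply: eq_bigr => j _; rewrite expr2. Qed.

Lemma dotrZr a u v : dotr u (a *: v) = a * dotr u v.
Proof. by rewrite mulr_sumr; apply: eq_bigr => j _; rewrite mxE mulrCA. Qed.

Lemma dotrN u v : dotr (- u) v = - dotr u v.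
Proof. by rewrite -sumrN; apply: eq_bigr => j _; rewrite mxE mulNr. Qed.

(** [grad] only records partial derivatives; linearity of the differential extends them to all
    directions. *)
Lemma derive_dotr_grad w v : 'D_v g w = dotr (grad g w) v.
Proof.
rewrite deriveE// [in LHS](row_sum_delta v) linear_sum; apply: eq_bigr => j _.
by rewrite linearZ /= mxE deriveE// mulrC.
Qed.

Lemma is_derive_line u v (s : R) :
  is_derive s 1 (fun s : R => g (u + s *: v)) (dotr (grad g (u + s *: v)) v).
Proof.
have E : (fun h : R => h^-1 *: (((fun s : R => g (u + s *: v)) \o shift s) (h *: 1)
                  - g (u + s *: v))) =
         (fun h : R => h^-1 *: ((g \o shift (u + s *: v)) (h *: v) - g (u + s *: v))).
  apply/funext => h /=; congr (_ *: (g _ - _)).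
  by rewrite [h *: 1](mulr1) scalerDl addrCA.
apply: DeriveDef.
  by rewrite /derivable E; exact: diff_derivable.
by rewrite -derive_dotr_grad /derive E.
Qed.

(** The mean value theorem for [g] along the segment minus an affine part and [c / 2 * s ^+ 2]. The
    quadratic term produces the sharp constant [beta / 2] below without integrating the gradient. *)
Lemma mvt_line u v c : exists2 s : R, 0 < s < 1 &
  g (u + v) - g u - dotr (grad g u) v - c / 2 =
  dotr (grad g (u + s *: v) - grad g u) v - c * s.
Proof.
pose phi (s : R) := g (u + s *: v) - (s * dotr (grad g u) v + c / 2 * s ^+ 2).
pose dphi (s : R) := dotr (grad g (u + s *: v)) v - (dotr (grad g u) v + c * s).
have dphiP (s : R) : is_derive s 1 phi (dphi s).
  apply: is_deriveB; first exact: is_derive_line.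
  apply: is_derive_eq.
  by rewrite /GRing.scale /=; field.
have [|s] := @MVT R phi dphi 0 1 ltr01 (fun x _ => dphiP x).
  apply: continuous_subspaceT => x.
  by apply/differentiable_continuous/derivable1_diffP; case: (dphiP x).
rewrite in_itv /= /phi /dphi => s01 e; exists s => //.
move: e; rewrite scale1r scale0r addr0 dotrBl.
set a := g _; set b := g _; lra.
Qed.

(** With [c] equal to plus or minus [beta * norm2 v ^+ 2], Cauchy-Schwarz and smoothness give the
    right side of [mvt_line] a sign, one for each half of the absolute value. *)
Lemma smooth_remainder u v :
  `|g (u + v) - g u - dotr (grad g u) v| <= beta / 2 * norm2 v ^+ 2.
Proof.
have N0 := norm2_ge0 v.
have key (s : R) w : 0 < s < 1 -> norm2 w = norm2 (grad g (u + s *: v) - grad g u) ->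
    dotr w v <= beta * norm2 v ^+ 2 * s.
  move=> /andP[s0 s1] wE; apply: le_trans (dotr_le _ _) _.
  have := smooth_g (u + s *: v) u.
  rewrite addrAC subrr add0r norm2Z gtr0_norm// -wE => h.
  by have := ler_wpM2r N0 h; rewrite expr2; lra.
have [s s01 e] := mvt_line u v (beta * norm2 v ^+ 2).
have [t t01 e'] := mvt_line u v (- (beta * norm2 v ^+ 2)).
have := key s _ s01 erefl.
have := key t (- (grad g (u + t *: v) - grad g u)) t01.
rewrite norm2N dotrN => /(_ erefl) h1 h2.
rewrite ler_norml; apply/andP; split; lra.
Qed.

(** A gradient step of size [beta^-1] lowers [g] by at least [norm2 (grad g w) ^+ 2 / (2 * beta)],
    yet [g] stays nonnegative. *)
Lemma sqr_norm2_grad_le w : (forall u, 0 <= g u) ->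
  norm2 (grad g w) ^+ 2 <= 2 * beta * g w.
Proof.
move=> g0; have := smooth_remainder w (- beta^-1 *: grad g w).
move=> /(le_trans (ler_norm _)); have := g0 (w + - beta^-1 *: grad g w).
rewrite dotrZr dotrr norm2Z normrN gtr0_norm ?invr_gt0// exprMn.
set N := norm2 _ ^+ 2; set a := g _; set b := g _ => a0 h.
have e : beta / 2 * (beta^-1 ^+ 2 * N) = beta^-1 * N / 2 by field; rewrite gt_eqF.
have : beta^-1 * N <= 2 * b by rewrite e in h; lra.
by rewrite ler_pdivrMl// mulrCA mulrA.
Qed.

(* AM-GM: [sqrt (2 beta g u) |v| <= l g u + beta |v|^2 / (2 l)] *)
Lemma smooth_dist_le u v (l : R) : (forall w, 0 <= g w) -> 0 < l ->
  `|g (u + v) - g u| <= l * g u + (l^-1 + 1) * (beta / 2 * norm2 v ^+ 2).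
Proof.
move=> g0 l0; have := smooth_remainder u v.
have h : norm2 (grad g u) * norm2 v <= l * g u + l^-1 * (beta / 2 * norm2 v ^+ 2).
  have := sqr_norm2_grad_le u g0; set a := norm2 _; set b := norm2 v => ag.
  have : 0 <= (a * l / beta - b) ^+ 2 by exact: sqr_ge0.
  have -> : l^-1 * (beta / 2 * b ^+ 2) = (beta * b ^+ 2) / (2 * l).
    by field; rewrite gt_eqF.
  have -> : (a * l / beta - b) ^+ 2 =
    (2 * l / beta) * (l * (a ^+ 2 / (2 * beta)) + (beta * b ^+ 2) / (2 * l) - a * b).
    by field; rewrite !gt_eqF.
  rewrite pmulr_rge0 ?divr_gt0 ?mulr_gt0// subr_ge0 => /le_trans; apply.
  rewrite lerD2r; apply: ler_wpM2l; first exact: ltW.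
  by rewrite ler_pdivrMr ?mulr_gt0// mulrC.
have h1 := dotr_le (grad g u) v.
have h2 := dotr_le (- grad g u) v; rewrite dotrN norm2N in h2.
rewrite !ler_norml => /andP[h3 h4]; apply/andP; split; lra.
Qed.

End Smooth.

(** * Measurability of the loss and its gradient along measurable maps *)

Section Caratheodory.
Context {R : realType} {d0 dX : measure_display}.
Context {Z : measurableType d0} {X : measurableType dX} {d : nat}.
Variable f : 'rV[R]_d -> Z -> R.
Hypothesis mf : forall w, measurable_fun setT (f w).
Variables (V : X -> 'rV[R]_d) (zeta : X -> Z).
Hypothesis mV : forall j, measurable_fun setT (fun x => V x ord0 j).
Hypothesis mzeta : measurable_fun setT zeta.

(* Rounding [V] to a grid leaves countably many values, so that [f] only needs
   to be measurable in its second argument; the grid is then refined. *)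
Lemma measurable_fun_grid (c : R) :
  measurable_fun setT
    (fun x => f (\row_j ((Num.floor (c * V x ord0 j))%:~R / c)) (zeta x)).
Proof.
(* The cell on which the rounded point is [q / c]; on it the function is [f] at a fixed first
   argument. *)
pose E (q : 'rV[int]_d) : set X :=
  \bigcap_(j in setT) [set x | Num.floor (c * V x ord0 j) = q ord0 j].
have mE q : measurable (E q).
  apply: fin_bigcap_measurable => [|j _]; first exact: finite_finset.
  rewrite (_ : [set x | _] = (fun x => c * V x ord0 j) @^-1`
      `[(q ord0 j)%:~R, (q ord0 j + 1)%:~R[%classic).
    rewrite -[_ @^-1` _]setTI.
    have mc : measurable_fun setT (fun x => c * V x ord0 j).
      exact: measurable_funM (measurable_cst _) (mV j).
    by apply: mc => //; exact: measurable_itv.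
  apply/seteqP; split => x /=; rewrite in_itv /= -floor_eq; first by move=> ->.
  by move/eqP.
move=> _ Y mY; rewrite setTI.
rewrite (_ : _ @^-1` _ = \bigcup_(q : 'rV[int]_d) (E q `&`
    (fun x => f (\row_j ((q ord0 j)%:~R / c)) (zeta x)) @^-1` Y)).
  apply: countable_bigcupT_measurable => [|q]; first exact: countableP.
  apply: measurableI => //; rewrite -[_ @^-1` _]setTI.
  have mq := measurableT_comp (mf (\row_j ((q ord0 j)%:~R / c))) mzeta.
  exact: mq.
apply/seteqP; split => x /=.
  move=> Yx; exists (\row_j Num.floor (c * V x ord0 j)) => //; split.
    by move=> j _ /=; rewrite mxE.
  rewrite /=; congr (Y (f _ _)): Yx; apply/rowP => j; by rewrite !mxE.
move=> [q _ [Eq]]; congr (Y (f _ _)); apply/rowP => j; rewrite !mxE.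
by rewrite (Eq j).
Qed.

Lemma cvg_grid (w : 'rV[R]_d) :
  (\row_j ((Num.floor (k.+1%:R * w ord0 j))%:~R / k.+1%:R) : 'rV[R]_d)
    @[k --> \oo] --> w.
Proof.
apply/cvg_ballP => e e0; near=> k; split => // i j.
rewrite !ord1 mxE /ball /=.
have k0 : 0 < k.+1%:R :> R by rewrite ltr0n.
have -> : w ord0 j - (Num.floor (k.+1%:R * w ord0 j))%:~R / k.+1%:R =
   (k.+1%:R * w ord0 j - (Num.floor (k.+1%:R * w ord0 j))%:~R) / k.+1%:R.
  by field; rewrite gt_eqF.
have := floor_itv (k.+1%:R * w ord0 j); rewrite intrD => /andP[h1 h2].
rewrite ger0_norm; last by rewrite divr_ge0 ?subr_ge0// ltW.
apply: (@le_lt_trans _ _ k.+1%:R^-1).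
  by rewrite ler_piMl ?invr_ge0 ?ltW//; lra.
near: k; exact: (near_infty_natSinv_lt (PosNum e0)).
Unshelve. all: end_near. Qed.

(** Continuity in the first argument makes the composite a pointwise limit of its grid
    approximations. *)
Lemma measurable_fun_caratheodory : (forall z w, {for w, continuous (f ^~ z)}) ->
  measurable_fun setT (fun x => f (V x) (zeta x)).
Proof.
move=> cf; apply: (measurable_fun_cvg (fun k => measurable_fun_grid k.+1%:R)).
move=> x _; exact: (continuous_cvg _ (cf (zeta x) (V x)) (cvg_grid (V x))).
Qed.

End Caratheodory.

Section MeasurableGrad.
Context {R : realType} {d0 dX : measure_display}.
Context {Z : measurableType d0} {X : measurableType dX} {d : nat}.
Variable f : 'rV[R]_d -> Z -> R.
Hypothesis mf : forall w, measurable_fun setT (f w).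
Hypothesis df : forall z w, differentiable (f ^~ z) w.

(** A partial derivative is the limit of difference quotients with steps [1 / (k + 1)], which are
    measurable by the previous section. *)
Lemma measurable_fun_grad (V : X -> 'rV[R]_d) (zeta : X -> Z) (j : 'I_d) :
  (forall j, measurable_fun setT (fun x => V x ord0 j)) ->
  measurable_fun setT zeta ->
  measurable_fun setT (fun x => grad (f ^~ (zeta x)) (V x) ord0 j).
Proof.
move=> mV mzeta.
have cf z w : {for w, continuous (f ^~ z)} by exact: differentiable_continuous.
pose h k x : R := k.+1%:R * (f (k.+1%:R^-1 *: delta_mx ord0 j + V x) (zeta x) -
  f (V x) (zeta x)).
apply: (@measurable_fun_cvg _ _ _ _ h) => [k|x _].
  apply: measurable_funM (measurable_cst _) _.
  apply: measurable_funB; apply: measurable_fun_caratheodory => // i.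
  rewrite (_ : (fun _ => _) = (fun x =>
     (k.+1%:R^-1 *: delta_mx ord0 j : 'rV[R]_d) ord0 i + V x ord0 i)).
    exact: measurable_funD (measurable_cst _) (mV i).
  by apply/funext => x; rewrite mxE.
rewrite mxE.
pose w := V x; pose v : 'rV[R]_d := delta_mx ord0 j.
have dv : (fun t : R => t^-1 *: (f (t *: v + w) (zeta x) - f w (zeta x))) @ 0^' -->
  'D_v (f ^~ (zeta x)) w by exact: (diff_derivable (df (zeta x) w)).
have /cvgr_dnbhsP/(_ (fun k => k.+1%:R^-1)) H := dv.
have {}H : k.+1%:R^-1^-1 *: (f (k.+1%:R^-1 *: v + w) (zeta x) - f w (zeta x))
  @[k --> \oo] --> 'D_v (f ^~ (zeta x)) w.
  apply: H; split=> [k|]; [by rewrite invr_eq0 pnatr_eq0|exact: cvg_harmonic].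
apply: cvg_trans H; apply: near_eq_cvg; near=> k.
by rewrite /h invrK.
Unshelve. all: end_near. Qed.

End MeasurableGrad.

(** * Iterated expectations over samples *)

Section GDMeasurable.
Context {R : realType} {d0 dX : measure_display}.
Context {Z : measurableType d0} {X : measurableType dX} {d n : nat}.
Variable f : 'rV[R]_d -> Z -> R.
Hypothesis mf : forall w, measurable_fun setT (f w).
Hypothesis df : forall z w, differentiable (f ^~ z) w.
Variables (W1 : 'rV[R]_d) (eta : nat -> R).

(** The sample is a function of a parameter, so that the lemma also covers samples assembled by
    [tinsert] from a point of a product space. *)
Lemma measurable_gd_iter (S : X -> n.-tuple Z) k j : measurable_fun setT S ->
  measurable_fun setT (fun x => gd_iter f n W1 eta (S x) k ord0 j).
Proof.
move=> mS; elim: k j => [|k IH] j /=; first exact: measurable_cst.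
rewrite (_ : (fun _ => _) = (fun x => gd_iter f n W1 eta (S x) k ord0 j -
  eta k.+1 / n%:R * \sum_(i < n)
    grad (f ^~ (tnth (S x) i)) (gd_iter f n W1 eta (S x) k) ord0 j)); last first.
  by apply/funext => x; rewrite !mxE summxE.
apply: measurable_funB; first exact: IH.
apply: measurable_funM; first exact: measurable_cst.
apply: measurable_sum => i; apply: measurable_fun_grad => //.
exact: (measurableT_comp (measurable_tnth i)).
Qed.

Lemma measurable_loss_gd (S : X -> n.-tuple Z) (zeta : X -> Z) k :
  measurable_fun setT S -> measurable_fun setT zeta ->
  measurable_fun setT (fun x => f (gd_iter f n W1 eta (S x) k) (zeta x)).
Proof.
move=> mS mzeta; apply: measurable_fun_caratheodory => // [j|z w].
  exact: measurable_gd_iter.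
exact: differentiable_continuous.
Qed.

Lemma measurable_sqr_norm2_grad_gd (S : X -> n.-tuple Z) (zeta : X -> Z) k :
  measurable_fun setT S -> measurable_fun setT zeta ->
  measurable_fun setT
    (fun x => norm2 (grad (f ^~ (zeta x)) (gd_iter f n W1 eta (S x) k)) ^+ 2).
Proof.
move=> mS mzeta; under eq_fun do rewrite sqr_norm2.
apply: measurable_sum => j; apply: measurable_funX; apply: measurable_fun_grad => // i.
exact: measurable_gd_iter.
Qed.

End GDMeasurable.

(** * Inserting an example into a sample *)

Section Insert.
Context {Z : Type} {m : nat}.

(** Two neighbouring samples are [tinsert j z S] and [tinsert j z' S] with a common [S]. *)
Definition tinsert (j : 'I_m.+1) (z : Z) (S : m.-tuple Z) : m.+1.-tuple Z :=
  [tuple (if unlift j k is Some k' then tnth S k' else z) | k < m.+1].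

Lemma tnth_tinsert j z S : tnth (tinsert j z S) j = z.
Proof. by rewrite tnth_mktuple unlift_none. Qed.

Lemma tnth_tinsert_lift j z S k : tnth (tinsert j z S) (lift j k) = tnth S k.
Proof. by rewrite tnth_mktuple liftK. Qed.

Lemma tinsert0 z S : tinsert ord0 z S = [tuple of z :: S].
Proof.
apply: eq_from_tnth => i; case: (unliftP ord0 i) => [k|] ->.
  by rewrite tnth_tinsert_lift tnthS.
by rewrite tnth_tinsert tnth0.
Qed.

(** The right side does not depend on [j]. Exchangeability enters in this form, as the iterates see
    the sample only through such sums. *)
Lemma sum_tinsert {V : nmodType} (h : Z -> V) j z S :
  \sum_(k < m.+1) h (tnth (tinsert j z S) k) = h z + \sum_(k < m) h (tnth S k).
Proof.
rewrite (bigD1_ord j)//= tnth_tinsert; congr (_ + _).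
by apply: eq_bigr => k _; rewrite tnth_tinsert_lift.
Qed.

End Insert.

Lemma tinsertS {Z : Type} {m : nat} (j : 'I_m.+1) (z z0 : Z) (S : m.-tuple Z) :
  tinsert (lift ord0 j) z [tuple of z0 :: S] = [tuple of z0 :: tinsert j z S].
Proof.
apply: eq_from_tnth => i; case: (unliftP (lift ord0 j) i) => [k|] ->; last first.
  by rewrite tnth_tinsert tnthS tnth_tinsert.
rewrite tnth_tinsert_lift; case: (unliftP ord0 k) => [l|] ->.
  rewrite tnthS (_ : lift (lift ord0 j) _ = lift ord0 (lift j l)); last first.
    by apply: val_inj; rewrite /= /bump /= !add1n ltnS; case: leq.
  by rewrite tnthS tnth_tinsert_lift.
rewrite (_ : lift (lift ord0 j) _ = ord0) ?tnth0//.
exact: val_inj.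
Qed.

Lemma measurable_tinsert {d1 d2 : measure_display} {X : measurableType d1}
  {Z : measurableType d2} {m : nat} (j : 'I_m.+1) (z : X -> Z) (S : X -> m.-tuple Z) :
  measurable_fun setT z -> measurable_fun setT S ->
  measurable_fun setT (fun x => tinsert j (z x) (S x)).
Proof.
move=> mz mS; apply/measurable_fun_tnthP => i /=.
case: (unliftP j i) => [k|] ->; rewrite /comp.
  under eq_fun do rewrite tnth_tinsert_lift.
  exact: (measurableT_comp (measurable_tnth k)).
by under eq_fun do rewrite tnth_tinsert.
Qed.

Section SampleE.
Context {R : realType} {d0 : measure_display} {Z : measurableType d0}.
Variable D : probability Z R.

(** The measure is built by induction as the law of [z :: S] under a product, and Tonelli identifies
    its integral with the iterated one. It makes the integration lemmas for a single measure
    applicable. *)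
Lemma sampleE_integral (n : nat) : exists Q : probability (n.-tuple Z) R,
  forall g, measurable_fun setT g -> (forall S, 0 <= g S)%E ->
  sampleE D n g = (\int[Q]_S g S)%E.
Proof.
elim: n => [|n [Q IH]].
  exists (dirac [tuple]) => g mg g0 /=; rewrite integral_dirac//.
  by rewrite diracT mul1e.
have mc : measurable_fun setT
    (fun x : Z * n.-tuple Z => [tuple of x.1 :: x.2] : n.+1.-tuple Z).
  exact: measurable_cons.
pose c : {mfun (Z * n.-tuple Z)%type >-> n.+1.-tuple Z} :=
  HB.pack (fun x : Z * n.-tuple Z => [tuple of x.1 :: x.2] : n.+1.-tuple Z)
    (isMeasurableFun.Build _ _ _ _ _ mc).
exists (distribution (D \x Q)%E c) => g mg g0 /=.
have mgc : measurable_fun setT (fun x : Z * n.-tuple Z => g [tuple of x.1 :: x.2]).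
  exact: measurableT_comp.
rewrite ge0_integral_pushforward//= fubini_tonelli1//.
apply: eq_integral => z _; rewrite IH//.
exact: (measurableT_comp mg (measurable_cons _ _)).
Qed.

Lemma measurable_sampleE {dX : measure_display} {X : measurableType dX} (n : nat)
    (g : X -> n.-tuple Z -> \bar R) :
  measurable_fun setT (fun x => g x.1 x.2) -> (forall x S, 0 <= g x S)%E ->
  measurable_fun setT (fun x => sampleE D n (g x)).
Proof.
move=> mg g0; have [Q QE] := sampleE_integral n.
rewrite (_ : (fun _ => _) = (fun x => \int[Q]_S g x S)%E).
  exact: (measurable_fun_fubini_tonelli_F (fun x => g x.1 x.2)).
by apply/funext => x; rewrite QE//; exact: (measurableT_comp mg (measurable_pair1 x)).
Qed.

(** Any coordinate may be integrated outermost: by induction, Tonelli exchanges it with the head of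
    the tuple. *)
Lemma sampleE_tinsert (m : nat) (j : 'I_m.+1) (g : m.+1.-tuple Z -> \bar R) :
  measurable_fun setT g -> (forall S, 0 <= g S)%E ->
  sampleE D m.+1 g = (\int[D]_z sampleE D m (fun S => g (tinsert j z S)))%E.
Proof.
elim: m j g => [|m IH] j g mg g0.
  by rewrite (ord1 j) /=; apply: eq_integral => z _; rewrite tinsert0.
rewrite [LHS]/=; case: (unliftP ord0 j) => [k|] ->; last first.
  apply: eq_integral => z _.
  suff -> : (fun S => g (tinsert ord0 z S)) = (fun S => g [tuple of z :: S]) by [].
  by apply/funext => S; rewrite tinsert0.
transitivity (\int[D]_z0 \int[D]_z
    sampleE D m (fun S => g [tuple of z0 :: tinsert k z S]))%E.
  apply: eq_integral => z0 _.
  apply: (IH k (fun t => g [tuple of z0 :: t])) => //.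
  exact: (measurableT_comp mg (measurable_cons _ _)).
rewrite (fubini_tonelli
  (fun x => sampleE D m (fun S => g [tuple of x.1 :: tinsert k x.2 S]))).
- apply: eq_integral => z _ /=; apply: eq_integral => z0 _; congr (sampleE _ _).
  by apply/funext => S; rewrite tinsertS.
- apply: (measurable_sampleE _ (fun x S => g [tuple of x.1 :: tinsert k x.2 S])) => //.
  apply: (measurableT_comp mg); apply: measurable_cons.
    exact: measurableT_comp.
  apply: measurable_tinsert => //; exact: measurableT_comp.
- move=> x; have [Q QE] := sampleE_integral m; rewrite QE ?integral_ge0//.
  apply: (measurableT_comp mg); apply: measurable_cons => //.
  exact: measurable_tinsert.
Qed.

End SampleE.

(** * Stability of gradient descent *)

Section GDStability.
Context {R : realType} {d0 : measure_display} {Z : measurableType d0} {d : nat}.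
Variables (f : 'rV[R]_d -> Z -> R) (W1 : 'rV[R]_d) (eta : nat -> R).

Lemma eq_gd_iter (n k : nat) (S S' : n.-tuple Z) :
  (forall h : Z -> 'rV[R]_d, \sum_(j < n) h (tnth S j) = \sum_(j < n) h (tnth S' j)) ->
  gd_iter f n W1 eta S k = gd_iter f n W1 eta S' k.
Proof.
by move=> SS'; elim: k => //= k ->; rewrite (SS' (fun z => grad (f ^~ z) _)).
Qed.

Variables (beta C : R) (m T : nat) (i : 'I_m.+1) (S : m.-tuple Z).
Hypothesis beta0 : 0 < beta.
Hypothesis smooth : forall z w u,
  norm2 (grad (f ^~ z) w - grad (f ^~ z) u) <= beta * norm2 (w - u).
Hypothesis eta_ge0 : forall t, (t < T)%N -> 0 <= eta t.+1.
Hypothesis eta_le : forall t, (t < T)%N -> eta t.+1 <= C / t.+1%:R.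
Hypothesis C0 : 0 < C.

Let W z k := gd_iter f m.+1 W1 eta (tinsert i z S) k.
Let g z k := norm2 (grad (f ^~ z) (W z k)).

(** The [m] shared examples contribute gradient differences, controlled by smoothness with
    [m / (m + 1) <= 1]; the replaced example contributes its two gradients in full. *)
Lemma gd_dist_step (z z' : Z) (k : nat) : (k < T)%N ->
  norm2 (W z k.+1 - W z' k.+1) <=
  (1 + beta * eta k.+1) * norm2 (W z k - W z' k)
    + eta k.+1 / m.+1%:R * (g z k + g z' k).
Proof.
move=> kT; have e0 := eta_ge0 _ kT.
rewrite {1 2}/W /= -/(W z k) -/(W z' k).
rewrite (sum_tinsert (fun s => grad (f ^~ s) (W z k))).
rewrite (sum_tinsert (fun s => grad (f ^~ s) (W z' k))).
set a := eta k.+1 / m.+1%:R; set w := W z k; set w' := W z' k.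
have a0 : 0 <= a by rewrite divr_ge0.
have -> : w - a *: (grad (f ^~ z) w + \sum_(j < m) grad (f ^~ (tnth S j)) w)
   - (w' - a *: (grad (f ^~ z') w' + \sum_(j < m) grad (f ^~ (tnth S j)) w')) =
   (w - w') + (- a *: grad (f ^~ z) w + a *: grad (f ^~ z') w') +
   - a *: \sum_(j < m) (grad (f ^~ (tnth S j)) w - grad (f ^~ (tnth S j)) w').
  rewrite sumrB; set p := \sum_(_ < _) _; set q := \sum_(_ < _) _.
  by apply/rowP => j; rewrite !mxE; ring.
have N0 := norm2_ge0 (w - w').
have h1 : norm2 (\sum_(j < m)
    (grad (f ^~ (tnth S j)) w - grad (f ^~ (tnth S j)) w')) <=
    m%:R * (beta * norm2 (w - w')).
  apply: le_trans (norm2_sum _ _ _) _.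
  rewrite -[in leRHS](card_ord m) mulr_natl -sumr_const.
  by apply: ler_sum => j _; exact: smooth.
have h2 : a * (m%:R * (beta * norm2 (w - w'))) <= beta * eta k.+1 * norm2 (w - w').
  have : a * m%:R <= eta k.+1.
    rewrite /a mulrAC ler_pdivrMr ?ltr0n//; apply: ler_wpM2l => //.
    by rewrite ler_nat.
  move=> /(ler_wpM2r (mulr_ge0 (ltW beta0) N0)).
  lra.
apply: le_trans (norm2D _ _) _.
have h3 := norm2D (w - w') (- a *: grad (f ^~ z) w + a *: grad (f ^~ z') w').
have h4 := norm2D (- a *: grad (f ^~ z) w) (a *: grad (f ^~ z') w').
rewrite !norm2Z normrN ger0_norm// in h4 *.
have h5 := ler_wpM2l a0 h1.
by rewrite /g -/w -/w'; lra.
Qed.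

(** Writing the distance bound as [k ^ e] times a sum turns the expanding recursion into an additive
    one, because [powR_succ_ge] absorbs the factor [1 + e / (k + 1)]. *)
Lemma gd_dist_le (z z' : Z) (k : nat) : (k <= T)%N ->
  norm2 (W z k - W z' k) <= k%:R `^ (beta * C) *
    \sum_(t < k) eta t.+1 / m.+1%:R * (g z t + g z' t) * t.+1%:R `^ (- (beta * C)).
Proof.
set e := beta * C; have e0 : 0 <= e by rewrite mulr_ge0// ltW.
elim: k => [_|k IH kT]; first by rewrite big_ord0 mulr0 subrr norm2_0.
apply: le_trans (gd_dist_step z z' k kT) _.
rewrite big_ord_recr /= [in leRHS]mulrDr.
have k0 : 0 < k.+1%:R `^ e by rewrite powR_gt0.
apply: lerD; last first.
  by rewrite powRN mulrCA divff ?mulr1// gt_eqF.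
set s := \sum_(_ < _) _ in IH *.
have s0 : 0 <= s.
  apply: sumr_ge0 => t _; rewrite mulr_ge0 ?powR_ge0//.
  rewrite mulr_ge0 ?addr_ge0 ?norm2_ge0//.
  by rewrite divr_ge0// eta_ge0// (ltn_trans (ltn_ord t)).
have h : 1 + beta * eta k.+1 <= 1 + e / k.+1%:R.
  by rewrite lerD2l /e -mulrA ler_wpM2l ?eta_le// ltW.
have h0 : 0 <= 1 + beta * eta k.+1.
  by rewrite addr_ge0// mulr_ge0 ?eta_ge0// ltW.
apply: le_trans (ler_wpM2l h0 (IH (ltnW kT))) _.
(* [powR_succ_ge] needs a positive index; at [k = 0] the sum is empty because both runs start at
   [W1]. *)
rewrite mulrA; case: k => [|k] in kT s IH s0 h h0 k0 *.
  by rewrite /s big_ord0 !mulr0.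
apply: ler_wpM2r => //; apply: le_trans (powR_succ_ge e k.+1 e0 isT).
by rewrite ler_wpM2r// powR_ge0.
Qed.

(** Cauchy-Schwarz after splitting each [eta] into two square roots. The factor [beta] on the left
    turns [beta * eta] into at most [e / t], so the weights sum to at most [Cbar]; the 2 comes from
    [(x + y) ^+ 2 <= 2 * (x ^+ 2 + y ^+ 2)]. *)
Lemma sqr_gd_dist_le (z z' : Z) : (0 < T)%N ->
  beta * norm2 (W z T - W z' T) ^+ 2 <=
  2 * (T%:R `^ (2 * (beta * C)) * Cbar (beta * C) T / m.+1%:R ^+ 2) *
    \sum_(t < T) eta t.+1 * (g z t ^+ 2 + g z' t ^+ 2).
Proof.
move=> T0; set e := beta * C; have e0 : 0 < e by rewrite mulr_gt0.
have h := gd_dist_le z z' T (leqnn T); rewrite -/e in h.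
pose F (t : 'I_T) := Num.sqrt (eta t.+1) * t.+1%:R `^ (- e).
pose G (t : 'I_T) := Num.sqrt (eta t.+1) * (g z t + g z' t).
have sq (t : 'I_T) : Num.sqrt (eta t.+1) ^+ 2 = eta t.+1.
  by rewrite sqr_sqrtr// eta_ge0.
have sE : \sum_(t < T) eta t.+1 / m.+1%:R * (g z t + g z' t) * t.+1%:R `^ (- e) =
    m.+1%:R^-1 * \sum_(t < T) F t * G t.
  rewrite mulr_sumr; apply: eq_bigr => t _; have := sq t.
  by rewrite /F /G; set q := Num.sqrt _ => <-; ring.
have Tp x : x%:R `^ (2 * e) = (x%:R `^ e) ^+ 2 :> R.
  by rewrite mulrC powRrM powR_mulrn// powR_ge0.
have hF : beta * \sum_(t < T) F t ^+ 2 <= Cbar e T.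
  apply: le_trans (sum_powR_le_Cbar e T e0 T0).
  rewrite big_add1 big_mkord mulr_sumr; apply: ler_sum => t _.
  rewrite /F exprMn sq powRN exprVn -Tp -powRN mulrA ler_wpM2r ?powR_ge0//.
  by rewrite /e -mulrA ler_wpM2l ?eta_le// ltW.
have hG : \sum_(t < T) G t ^+ 2 <=
    2 * \sum_(t < T) eta t.+1 * (g z t ^+ 2 + g z' t ^+ 2).
  rewrite mulr_sumr; apply: ler_sum => t _; rewrite /G exprMn sq [leRHS]mulrCA.
  rewrite ler_wpM2l ?eta_ge0//; have := sqr_ge0 (g z t - g z' t); lra.
have CS := cauchy_schwarz_sum R _ (index_enum 'I_T) xpredT F G.
set s := \sum_(t < T) eta _ * _ in hG *.
have G0 : 0 <= \sum_(t < T) G t ^+ 2 by apply: sumr_ge0 => t _; exact: sqr_ge0.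
have C1 : 0 <= Cbar e T.
  apply: le_trans hF; apply: mulr_ge0; first exact: ltW.
  by apply: sumr_ge0 => t _; exact: sqr_ge0.
rewrite sE in h.
have h2 : norm2 (W z T - W z' T) ^+ 2 <=
    (T%:R `^ e * (m.+1%:R^-1 * \sum_(t < T) F t * G t)) ^+ 2.
  by rewrite ler_sqr ?nnegrE ?norm2_ge0// (le_trans _ h)// norm2_ge0.
apply: le_trans (ler_wpM2l (ltW beta0) h2) _.
have -> : 2 * (T%:R `^ (2 * e) * Cbar e T / m.+1%:R ^+ 2) * s =
    (T%:R `^ e / m.+1%:R) ^+ 2 * (Cbar e T * (2 * s)).
  by rewrite Tp exprMn exprVn; ring.
have -> : beta * (T%:R `^ e * (m.+1%:R^-1 * \sum_(t < T) F t * G t)) ^+ 2 =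
    (T%:R `^ e / m.+1%:R) ^+ 2 * (beta * (\sum_(t < T) F t * G t) ^+ 2) by ring.
apply: ler_wpM2l; first exact: sqr_ge0.
apply: le_trans (ler_wpM2l (ltW beta0) CS) _; rewrite [leLHS]mulrA.
apply: le_trans (ler_wpM2r G0 hF) _.
exact: ler_wpM2l.
Qed.

End GDStability.

(** * Integration over a sample and an independent copy *)

(* A point [(z, (z', S))] consists of the example at the index [i], its
   independent copy, and the rest of the sample. *)
Section TripleProduct.
Context {R : realType} {d1 d2 : measure_display}.
Context {Z : measurableType d1} {Y : measurableType d2}.
Variables (D : probability Z R) (Q : probability Y R).

(** The ascribed type lets the product serve as a factor of a further product. *)
Definition product_probability : probability (Z * Y)%type R := (D \x Q)%E.

Local Notation DQ := product_probability.

Variable h : Z * Y -> \bar R.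
Hypothesis mh : measurable_fun setT h.
Hypothesis h0 : forall x, (0 <= h x)%E.

Lemma measurable_pair_drop :
  measurable_fun setT (fun x : Z * (Z * Y) => (x.1, x.2.2)).
Proof.
by apply: measurable_fun_pair => //; exact: (measurableT_comp measurable_snd).
Qed.

(** The original example integrates out with mass one, leaving the sample that holds the copy. *)
Lemma integral_triple_snd :
  (\int[(D \x DQ)%E]_x h x.2 = \int[D]_z \int[Q]_y h (z, y))%E.
Proof.
rewrite (fubini_tonelli1 (fun x : Z * (Z * Y) => h x.2))//=; last first.
  exact: measurableT_comp.
rewrite -[RHS](fubini_tonelli1 h mh h0) /fubini_F /=.
rewrite (integral_cst D measurableT (\int[DQ]_x h x)%E).
by rewrite [X in (_ * X)%E](_ : _ = 1%E) ?mule1//; exact: (probability_setT D).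
Qed.

(** Here it is the copy that integrates out. *)
Lemma integral_triple_drop :
  (\int[(D \x DQ)%E]_x h (x.1, x.2.2) = \int[D]_z \int[Q]_y h (z, y))%E.
Proof.
rewrite (fubini_tonelli1 (fun x : Z * (Z * Y) => h (x.1, x.2.2)))//=; last first.
  exact: (measurableT_comp mh measurable_pair_drop).
apply: eq_integral => z _; rewrite /fubini_F /=.
rewrite (fubini_tonelli1 (fun x : Z * Y => h (z, x.2)))//=; last first.
  apply: (measurableT_comp mh); apply: measurable_fun_pair => //.
rewrite /fubini_F /= (integral_cst D measurableT (\int[Q]_y h (z, y))%E).
by rewrite [X in (_ * X)%E](_ : _ = 1%E) ?mule1//; exact: (probability_setT D).
Qed.

End TripleProduct.

(** * Integrating a pointwise bound on a difference *)

Section FineIntegral.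
Context {R : realType} {dX : measure_display} {X : measurableType dX}.
Variable mu : probability X R.

(** In the application [p] and [q] are the two losses at the copy, and [u], [v] the squared
    gradients of the two runs; their equal integrals [s] explain the factor 2. *)
Lemma integral_affine_dominated (T : nat) (p q : X -> R) (u v : 'I_T -> X -> R)
    (eta : 'I_T -> R) (l c a b : R) (s : 'I_T -> R) :
  measurable_fun setT p -> measurable_fun setT q ->
  (forall t, measurable_fun setT (u t)) -> (forall t, measurable_fun setT (v t)) ->
  (forall x, 0 <= p x) -> (forall x, 0 <= q x) ->
  (forall t x, 0 <= u t x) -> (forall t x, 0 <= v t x) ->
  (forall t, 0 <= eta t) -> 0 <= l -> 0 <= c ->
  (\int[mu]_x (p x)%:E = a%:E)%E -> (\int[mu]_x (q x)%:E = b%:E)%E ->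
  (forall t, \int[mu]_x (u t x)%:E = (s t)%:E)%E ->
  (forall t, \int[mu]_x (v t x)%:E = (s t)%:E)%E ->
  (forall x, `|p x - q x| <= l * q x + c * \sum_t eta t * (u t x + v t x)) ->
  `|a - b| <= l * b + 2 * c * \sum_t eta t * s t.
Proof.
move=> mp mq mu_ mv p0 q0 u0 v0 e0 l0 c0 pa qb us vs h.
pose H x := l * q x + c * \sum_t eta t * (u t x + v t x).
have Ht0 t x : 0 <= eta t * (u t x + v t x) by rewrite mulr_ge0 ?addr_ge0.
have Hs0 x : 0 <= \sum_t eta t * (u t x + v t x) by exact: sumr_ge0.
have H0 x : 0 <= H x by rewrite addr_ge0 ?mulr_ge0.
have mHt t : measurable_fun setT (fun x => eta t * (u t x + v t x)).
  by apply: measurable_funM; [exact: measurable_cst|exact: measurable_funD].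
have mHs : measurable_fun setT (fun x => \sum_t eta t * (u t x + v t x)).
  exact: measurable_sum.
have mlq : measurable_fun setT (fun x => l * q x).
  exact: measurable_funM (measurable_cst _) mq.
have mcs : measurable_fun setT (fun x => c * \sum_t eta t * (u t x + v t x)).
  exact: measurable_funM (measurable_cst _) mHs.
have mH : measurable_fun setT H by exact: measurable_funD.
have HE : (\int[mu]_x (H x)%:E = (l * b + 2 * c * \sum_t eta t * s t)%:E)%E.
  rewrite /H; under eq_integral do rewrite EFinD.
  rewrite ge0_integralD//=; last 4 first.
  - by move=> x _; rewrite lee_fin mulr_ge0.
  - exact/measurable_EFinP.
  - by move=> x _; rewrite lee_fin mulr_ge0.
  - exact/measurable_EFinP.
  under eq_integral do rewrite EFinM.
  rewrite ge0_integralZl_EFin//=; last 2 first.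
  - by move=> x _; rewrite lee_fin.
  - exact/measurable_EFinP.
  under [X in (_ + X)%E]eq_integral do rewrite EFinM.
  rewrite ge0_integralZl_EFin//=; last 2 first.
  - by move=> x _; rewrite lee_fin.
  - exact/measurable_EFinP.
  under [X in (_ + _ * X)%E]eq_integral do rewrite -sumEFin.
  rewrite ge0_integral_sum//=; last 2 first.
  - by move=> t; exact/measurable_EFinP.
  - by move=> t x _; rewrite lee_fin.
  rewrite qb -EFinM (eq_bigr (fun t => (eta t * (s t + s t))%:E)).
    rewrite sumEFin -EFinM -EFinD; congr (_%:E); congr (_ + _).
    rewrite -mulrA mulrCA; congr (c * _); rewrite mulr_sumr.
    by apply: eq_bigr => t _; ring.
  move=> t _; under eq_integral do rewrite EFinM.
  rewrite ge0_integralZl_EFin//=; last 2 first.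
  - by move=> x _; rewrite lee_fin addr_ge0.
  - by apply/measurable_EFinP; exact: measurable_funD.
  under eq_integral do rewrite EFinD.
  rewrite ge0_integralD//=; last 4 first.
  - by move=> x _; rewrite lee_fin.
  - exact/measurable_EFinP.
  - by move=> x _; rewrite lee_fin.
  - exact/measurable_EFinP.
  by rewrite us vs.
(* Keeping [q1] on the larger side leaves only nonnegative integrands; the subtraction happens
   between real numbers. *)
have key (p1 q1 : X -> R) (a1 b1 : R) :
    measurable_fun setT p1 -> measurable_fun setT q1 ->
    (forall x, 0 <= p1 x) -> (forall x, 0 <= q1 x) ->
    (\int[mu]_x (p1 x)%:E = a1%:E)%E -> (\int[mu]_x (q1 x)%:E = b1%:E)%E ->
    (forall x, p1 x <= q1 x + H x) ->
    a1 - b1 <= l * b + 2 * c * \sum_t eta t * s t.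
  move=> mp1 mq1 p10 q10 I1 I2 pq.
  rewrite lerBlDl -lee_fin EFinD -I1 -I2 -HE -ge0_integralD//=; last 4 first.
  - by move=> x _; rewrite lee_fin.
  - exact/measurable_EFinP.
  - by move=> x _; rewrite lee_fin.
  - exact/measurable_EFinP.
  apply: ge0_le_integral => //=.
  - by move=> x _; rewrite lee_fin.
  - exact/measurable_EFinP.
  - by apply/measurable_EFinP; exact: measurable_funD.
  - by move=> x _; rewrite -EFinD lee_fin.
rewrite ler_norml; apply/andP; split.
  rewrite lerNl opprB; apply: (key q p) => // x.
  by have := h x; rewrite ler_norml => /andP[]; rewrite /H; lra.
apply: (key p q) => // x.
by have := h x; rewrite ler_norml => /andP[]; rewrite /H; lra.
Qed.

End FineIntegral.

(** * The expectations of the theorem as integrals over the inserted example *)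

Section Expectations.
Context {R : realType} {d0 : measure_display} {Z : measurableType d0} {d : nat}.
Variables (D : probability Z R) (f : 'rV[R]_d -> Z -> R).
Variables (W1 : 'rV[R]_d) (eta : nat -> R).
Hypothesis f0 : forall w z, 0 <= f w z.
Hypothesis mf : forall w, measurable_fun setT (f w).
Hypothesis df : forall z w, differentiable (f ^~ z) w.
Variables (m : nat) (i : 'I_m.+1) (Q : probability (m.-tuple Z) R).
Hypothesis QE : forall g, measurable_fun setT g -> (forall S, 0 <= g S)%E ->
  sampleE D m g = (\int[Q]_S g S)%E.

Lemma sampleE_tinsert_integral (j : 'I_m.+1) (g : m.+1.-tuple Z -> \bar R) :
  measurable_fun setT g -> (forall S, 0 <= g S)%E ->
  sampleE D m.+1 g = (\int[D]_z \int[Q]_S g (tinsert j z S))%E.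
Proof.
move=> mg g0; rewrite (sampleE_tinsert D m j g mg g0); apply: eq_integral => z _.
by rewrite QE//; apply: (measurableT_comp mg); exact: measurable_tinsert.
Qed.

Lemma E_gradsqE (t : nat) : E_gradsq D f m.+1 W1 eta i t.+1 =
  (\int[D]_z \int[Q]_S
    (norm2 (grad (f ^~ z) (gd_iter f m.+1 W1 eta (tinsert i z S) t)) ^+ 2)%:E)%E.
Proof.
rewrite /E_gradsq (sampleE_tinsert_integral i).
- by apply: eq_integral => z _; apply: eq_integral => S _; rewrite tnth_tinsert.
- apply/measurable_EFinP; apply: measurable_sqr_norm2_grad_gd => //.
  exact: measurable_tnth.
- by move=> S; rewrite lee_fin sqr_ge0.
Qed.

(** All terms of the empirical risk have the same expectation: the [j]-th is computed by inserting
    at [j], and symmetry of the iterates moves the insertion to [i]. *)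
Lemma E_emp_outE (T : nat) : E_emp_out D f m.+1 W1 eta T =
  (\int[D]_z \int[Q]_S (f (gd_out f m.+1 W1 eta T (tinsert i z S)) z)%:E)%E.
Proof.
set V := RHS.
have mj j : measurable_fun setT
    (fun S : m.+1.-tuple Z => f (gd_out f m.+1 W1 eta T S) (tnth S j)).
  by apply: measurable_loss_gd => //; exact: measurable_tnth.
have VE j : sampleE D m.+1
    (fun S => (f (gd_out f m.+1 W1 eta T S) (tnth S j))%:E) = V.
  rewrite (sampleE_tinsert_integral j); last 2 first.
  - exact/measurable_EFinP.
  - by move=> S; rewrite lee_fin.
  apply: eq_integral => z _; apply: eq_integral => S _.
  rewrite tnth_tinsert /gd_out (@eq_gd_iter _ _ _ _ _ _ _ _ _ _ (tinsert i z S))//.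
  by move=> h; rewrite !sum_tinsert.
have [Q' Q'E] := sampleE_integral D m.+1.
rewrite /E_emp_out /emp_risk Q'E; last 2 first.
- apply/measurable_EFinP; apply: measurable_funM; first exact: measurable_cst.
  exact: measurable_sum.
- by move=> S; rewrite lee_fin mulr_ge0// sumr_ge0.
under eq_integral do rewrite EFinM -sumEFin.
rewrite ge0_integralZl_EFin//=; last 2 first.
- by move=> S _; apply: sume_ge0 => j _; rewrite lee_fin.
- by apply: emeasurable_sum => j; exact/measurable_EFinP.
rewrite ge0_integral_sum//=; last 2 first.
- by move=> j; exact/measurable_EFinP.
- by move=> j S _; rewrite lee_fin.
(* [V] may be infinite here, so it is factored out of a sum of nonnegative finite terms. *)
rewrite (eq_bigr (fun=> 1%:E * V)%E) => [|j _]; last first.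
  rewrite mul1e -(VE j) Q'E//; first exact/measurable_EFinP.
  by move=> S; rewrite lee_fin.
rewrite -ge0_sume_distrl// sumEFin sumr_const card_ord muleA -EFinM.
by rewrite mulVf ?mul1e// pnatr_eq0.
Qed.

(** The test example of the population risk becomes the independent copy, by Tonelli. *)
Lemma E_pop_outE (T : nat) : E_pop_out D f m.+1 W1 eta T =
  (\int[(D \x product_probability D Q)%E]_x
     (f (gd_out f m.+1 W1 eta T (tinsert i x.1 x.2.2)) x.2.1)%:E)%E.
Proof.
have mfS : measurable_fun setT (fun x : m.+1.-tuple Z * Z =>
    (f (gd_out f m.+1 W1 eta T x.1) x.2)%:E).
  by apply/measurable_EFinP; exact: measurable_loss_gd.
rewrite /E_pop_out (sampleE_tinsert_integral i); last 2 first.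
- apply: (measurable_fun_fubini_tonelli_F (fun x : m.+1.-tuple Z * Z =>
    (f (gd_out f m.+1 W1 eta T x.1) x.2)%:E)) => //.
  by move=> x; rewrite lee_fin.
- by move=> S; apply: integral_ge0 => z _; rewrite lee_fin.
rewrite (fubini_tonelli1 (fun x : Z * (Z * m.-tuple Z) =>
   (f (gd_out f m.+1 W1 eta T (tinsert i x.1 x.2.2)) x.2.1)%:E)); last 2 first.
- apply/measurable_EFinP; apply: measurable_loss_gd => //; last exact: measurableT_comp.
  by apply: measurable_tinsert => //; exact: measurableT_comp.
- by move=> x; rewrite lee_fin.
apply: eq_integral => z _; rewrite /fubini_F /=.
rewrite (fubini_tonelli2 (fun x : Z * m.-tuple Z =>
   (f (gd_out f m.+1 W1 eta T (tinsert i z x.2)) x.1)%:E))//.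
  apply/measurable_EFinP; apply: measurable_loss_gd => //.
  by apply: measurable_tinsert => //; exact: measurableT_comp.
by move=> x; rewrite lee_fin.
Qed.

End Expectations.

(** * The generalization bound *)

Theorem theorem8 (R : realType) (d0 : measure_display) (Z : measurableType d0)
  (D : probability Z R) (d n T : nat) (f : 'rV[R]_d -> Z -> R)
  (beta C : R) (eta : nat -> R) (W1 : 'rV[R]_d)
  (Wstar : n.-tuple Z -> 'rV[R]_d) (i : 'I_n) :
  (0 < n)%N -> (0 < T)%N ->
  (forall w z, 0 <= f w z) ->
  (forall w, measurable_fun setT (f w)) ->
  0 < beta ->
  (forall z w, differentiable (f ^~ z) w) ->
  (forall z w u, norm2 (grad (f ^~ z) w - grad (f ^~ z) u) <= beta * norm2 (w - u)) ->
  (forall S : n.-tuple Z, forall w, emp_risk f n S (Wstar S) <= emp_risk f n S w) ->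
  (forall t : nat, (1 <= t <= T.+1)%N ->
     0 < eta t /\ eta t <= C / t%:R /\ C / t%:R <= beta^-1) ->
  beta * C < 1 ->
  E_pop_out D f n W1 eta T \is a fin_num ->
  E_emp_out D f n W1 eta T \is a fin_num ->
  E_emp_star D f n Wstar \is a fin_num ->
  (forall t : nat, (1 <= t <= T)%N -> E_gradsq D f n W1 eta i t \is a fin_num) ->
  let eps := beta * C in
  let gen := eps_gen D f n W1 eta T in
  let opt := eps_opt D f n W1 eta T Wstar in
  let c := eps_c D f n Wstar in
  let path := eps_path D f n W1 eta T i in
  `| gen | <=
     4 * Num.sqrt 2 / n%:R * Num.sqrt ((opt + c) * path)
       * (expR 1 * T%:R) `^ eps * Num.sqrt (Cbar eps T)
     + 8 * (path / n%:R ^+ 2) * (expR 1 * T%:R) `^ (2 * eps) * Cbar eps T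
  /\
  4 * Num.sqrt 2 / n%:R * Num.sqrt ((opt + c) * path)
       * (expR 1 * T%:R) `^ eps * Num.sqrt (Cbar eps T)
     + 8 * (path / n%:R ^+ 2) * (expR 1 * T%:R) `^ (2 * eps) * Cbar eps T
  <= 4 * Num.sqrt 3 * (expR 1 * T%:R) `^ eps / n%:R * Num.sqrt ((opt + c) * path)
     + 12 * ((expR 1 * T%:R) `^ (2 * eps) / n%:R ^+ 2) * path.

Proof.
case: n Wstar i => [|m] Wstar i // _ T0 f0 mf beta0 df smooth Wmin eta_bd eps1.
move=> pop_fin emp_fin star_fin grad_fin eps gen opt c path.
have eta_ge0 t : (t < T)%N -> 0 <= eta t.+1.
  by move=> tT; have [|/ltW] := eta_bd t.+1; first by rewrite /= ltnS ltnW.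
have eta_le t : (t < T)%N -> eta t.+1 <= C / t.+1%:R.
  by move=> tT; have [|_ []] := eta_bd t.+1; first by rewrite /= ltnS ltnW.
have C0 : 0 < C.
  have [//|e1 [e2 _]] := eta_bd 1%N.
  by apply: lt_le_trans e1 _; rewrite divr1 in e2.
have e0 : 0 < eps by exact: mulr_gt0.
have eT1 : 1 <= expR 1 * T%:R :> R.
  by rewrite mulr_ege1// ?ler1n// ltW// expR_gt1.
set K := (expR 1 * T%:R) `^ eps.
have K0 : 0 <= K by exact: powR_ge0.
have K2 : (expR 1 * T%:R) `^ (2 * eps) = K ^+ 2.
  by rewrite [2 * eps]mulrC powRrM powR_mulrn//.
have Cb0 : 0 <= Cbar eps T.
  apply: le_trans (sum_powR_le_Cbar eps T e0 T0); apply: sumr_ge0 => t _.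
  by rewrite mulr_ge0 ?powR_ge0// divr_ge0// ltW.
(* From the first branch of the minimum and [eps < 1]. It yields the constants of the second
   inequality: [sqrt 2 * sqrt (3 / 2) = sqrt 3] and [8 * (3 / 2) = 12]. *)
have Cb32 : Cbar eps T <= 3 / 2 by rewrite /Cbar ge_min; apply/orP; left; rewrite /eps; lra.
have [Q QE] := sampleE_integral D m.
pose s (t : nat) : R := fine (E_gradsq D f m.+1 W1 eta i t.+1).
have s0 t : 0 <= s t.
  rewrite /s fine_ge0// (E_gradsqE D f W1 eta mf df m i Q QE).
  by apply: integral_ge0 => z _; apply: integral_ge0 => S _; rewrite lee_fin sqr_ge0.
have pathE : path = \sum_(t < T) eta t.+1 * s t.
  by rewrite /path /eps_path big_add1 big_mkord.
have path0 : 0 <= path.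
  by rewrite pathE; apply: sumr_ge0 => t _; rewrite mulr_ge0 ?eta_ge0.
set a := fine (E_emp_out D f m.+1 W1 eta T).
have a0 : 0 <= a.
  rewrite /a fine_ge0// (E_emp_outE D f W1 eta f0 mf df m i Q QE).
  by apply: integral_ge0 => z _; apply: integral_ge0 => S _; rewrite lee_fin.
have optc : opt + c = a by rewrite /opt /c /eps_opt /eps_c subrK.
rewrite optc K2.
have n0 : 0 < m.+1%:R :> R by rewrite ltr0n.
split; last first.
  apply: lerD.
    have -> : Num.sqrt 3 = Num.sqrt 2 * Num.sqrt (3 / 2) :> R.
      by rewrite -sqrtrM//; congr Num.sqrt; field.
    rewrite -!mulrA; apply: ler_wpM2l => //; apply: ler_wpM2l; first exact: sqrtr_ge0.
    have : Num.sqrt (Cbar eps T) <= Num.sqrt (3 / 2) by exact: ler_wsqrtr.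
    set x := Num.sqrt (Cbar _ _); set y := Num.sqrt (3 / 2) => xy.
    set b := Num.sqrt (a * path).
    rewrite (_ : m.+1%:R^-1 * (b * (K * x)) = (m.+1%:R^-1 * b * K) * x); last by ring.
    rewrite (_ : y * _ = (m.+1%:R^-1 * b * K) * y); last by ring.
    apply: ler_wpM2l => //; rewrite !mulr_ge0 ?sqrtr_ge0// invr_ge0 ltW//.
  rewrite (_ : 8 * _ * _ * _ = 8 * (path / m.+1%:R ^+ 2 * K ^+ 2) * Cbar eps T); last by ring.
  rewrite (_ : 12 * _ * _ = 8 * (path / m.+1%:R ^+ 2 * K ^+ 2) * (3 / 2)); last by field.
  by apply: ler_wpM2l => //; rewrite mulr_ge0// mulr_ge0 ?sqr_ge0// divr_ge0// sqr_ge0.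
(* A bound on the expectation of [beta / 2] times the squared distance of the outputs; the 2 counts
   the two runs, each contributing [path]. *)
set B := 2 * (K ^+ 2 * Cbar eps T / m.+1%:R ^+ 2) * path.
have B0 : 0 <= B.
  by rewrite mulr_ge0// mulr_ge0// divr_ge0 ?sqr_ge0// mulr_ge0 ?sqr_ge0.
have main l : 0 < l -> `|gen| <= l * a + (l^-1 + 1) * B.
  move=> l0; have l1 : 0 <= l^-1 + 1 by rewrite addr_ge0// invr_ge0 ltW.
  pose mu : probability _ R := (D \x product_probability D Q)%E.
  pose W z S k := gd_iter f m.+1 W1 eta (tinsert i z S) k.
  pose G z S t := norm2 (grad (f ^~ z) (W z S t)) ^+ 2.
  have m1 : measurable_fun setT (fun x : Z * (Z * m.-tuple Z) => x.2.1).
    exact: measurableT_comp.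
  have m2 : measurable_fun setT (fun x : Z * (Z * m.-tuple Z) => x.2.2).
    exact: measurableT_comp.
  have mG (t : 'I_T) : measurable_fun setT
      (fun x : Z * m.-tuple Z => (G x.1 x.2 t)%:E).
    apply/measurable_EFinP; apply: measurable_sqr_norm2_grad_gd => //.
    exact: measurable_tinsert.
  have G0 (t : 'I_T) x : (0 <= (G x.1 x.2 t)%:E)%E by rewrite lee_fin sqr_ge0.
  have GE (t : 'I_T) : (\int[D]_z \int[Q]_S (G z S t)%:E = (s t)%:E)%E.
    by rewrite -(E_gradsqE D f W1 eta mf df m i Q QE) fineK// grad_fin// ltn_ord.
  have mF : measurable_fun setT
      (fun x : Z * m.-tuple Z => (f (W x.1 x.2 T) x.1)%:E).
    apply/measurable_EFinP; apply: measurable_loss_gd => //.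
    exact: measurable_tinsert.
  have Hsum : 2 * ((l^-1 + 1) * (K ^+ 2 * Cbar eps T / m.+1%:R ^+ 2)) * path =
     (l^-1 + 1) * B by rewrite /B; ring.
  rewrite -Hsum pathE.
  apply: (@integral_affine_dominated _ _ _ mu T
    (fun x => f (W x.1 x.2.2 T) x.2.1) (fun x => f (W x.2.1 x.2.2 T) x.2.1)
    (fun t x => G x.1 x.2.2 t) (fun t x => G x.2.1 x.2.2 t)
    (fun t => eta t.+1)) => //.
  - apply: measurable_loss_gd => //; exact: measurable_tinsert.
  - apply: measurable_loss_gd => //; exact: measurable_tinsert.
  - move=> t; apply: measurable_sqr_norm2_grad_gd => //; exact: measurable_tinsert.
  - move=> t; apply: measurable_sqr_norm2_grad_gd => //; exact: measurable_tinsert.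
  - by move=> t x; exact: sqr_ge0.
  - by move=> t x; exact: sqr_ge0.
  - by move=> t; exact: eta_ge0.
  - exact: ltW.
  - by rewrite mulr_ge0// divr_ge0 ?sqr_ge0// mulr_ge0 ?sqr_ge0.
  - by rewrite -(E_pop_outE D f W1 eta f0 mf df m i Q QE) fineK.
  - rewrite (integral_triple_snd D Q (fun x => (f (W x.1 x.2 T) x.1)%:E))//.
      by rewrite -(E_emp_outE D f W1 eta f0 mf df m i Q QE) fineK.
    by move=> x; rewrite lee_fin.
  - by move=> t; rewrite (integral_triple_drop D Q (fun x => (G x.1 x.2 t)%:E)).
  - by move=> t; rewrite (integral_triple_snd D Q (fun x => (G x.1 x.2 t)%:E)).
  move=> [z [z' S]] /=.
  (* The base point is the output trained on [z'], so that [l] multiplies a training loss, of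
     expectation [a]. *)
  have := smooth_dist_le (f ^~ z') beta beta0 (df z') (smooth z')
    (W z' S T) (W z S T - W z' S T) l (f0 ^~ z') l0.
  rewrite [W z' S T + _]addrC subrK => /le_trans; apply; rewrite lerD2l -[leRHS]mulrA.
  apply: ler_wpM2l => //.
  have := @sqr_gd_dist_le R d0 Z d f W1 eta beta C m T i S beta0 smooth
    eta_ge0 eta_le C0 z z' T0; rewrite -/eps -!/(W _ _ _).
  set P := \sum_(t < T) _; set N := norm2 _ ^+ 2 => hN.
  have P0 : 0 <= P.
    apply: sumr_ge0 => t _; apply: mulr_ge0; first exact: eta_ge0.
    by rewrite addr_ge0 ?sqr_ge0.
  (* The stability bound has [T] as base of the power; it is weakened to [e T], the base in [K]. *)
  apply: (@le_trans _ _ (T%:R `^ (2 * eps) * Cbar eps T / m.+1%:R ^+ 2 * P)).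
    by move: hN; set M := _ * _ / _; lra.
  apply: ler_wpM2r => //; apply: ler_wpM2r; first by rewrite invr_ge0 sqr_ge0.
  apply: ler_wpM2r => //; rewrite -K2; apply: ge0_ler_powR.
  - by rewrite mulr_ge0// ltW.
  - by rewrite nnegrE.
  - by rewrite nnegrE (le_trans _ eT1).
  - by rewrite ler_peMl// ltW// expR_gt1.
have H : `|gen| - B <= 2 * Num.sqrt (a * B).
  by apply: young_optimize => // l l0; have := main l l0; lra.
have sE : Num.sqrt (a * B) =
    Num.sqrt (a * path) * (K / m.+1%:R) * Num.sqrt 2 * Num.sqrt (Cbar eps T).
  have -> : a * B = a * path * ((K / m.+1%:R) ^+ 2 * (2 * Cbar eps T)).
    by rewrite /B exprMn exprVn; ring.
  rewrite sqrtrM ?mulr_ge0// [Num.sqrt (_ ^+ 2 * _)]sqrtrM ?sqr_ge0// sqrtr_sqr.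
  by rewrite [Num.sqrt (2 * _)]sqrtrM// ger0_norm ?divr_ge0// !mulrA.
(* The claimed bound equals [4 * sqrt (a * B) + 4 * B], which dominates the [2 * sqrt (a * B) + B]
   obtained in [H]. *)
rewrite (_ : 4 * _ / _ * _ * _ * _ = 4 * Num.sqrt (a * B)); last by rewrite sE; ring.
rewrite (_ : 8 * _ * _ * _ = 4 * B); last by rewrite /B; ring.
have := sqrtr_ge0 (a * B); lra.
Qed.
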